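(* Let $m\ge 2$, $n\ge 1$ and let $\mathcal{A}=(a_{i_1\cdots i_m})\in T_{m,n}$. Then: (i) $\mathcal{A}$ is an R$_0$-tensor if and only if the tensor complementarity problem $(\mathbf{0},\mathcal{A})$ has the unique solution $\mathbf{0}$; (ii) $\mathcal{A}$ is an R-tensor if and only if $\mathcal{A}$ is an R$_0$-tensor and the tensor complementarity problem $(\mathbf{e},\mathcal{A})$ has the unique solution $\mathbf{0}$, where $\mathbf{e}=(1,1,\ldots,1)^\top\in\mathbb{R}^n$.
   Context: $T_{m,n}$ is the set of real $m$th order $n$-dimensional tensors $\mathcal{A}=(a_{i_1\cdots i_m})$, with real entries indexed by $i_1,\ldots,i_m\in I_n:=\{1,\ldots,n\}$ (no symmetry assumed). For $\mathbf{x}\in\mathbb{R}^n$, $\mathcal{A}\mathbf{x}^{m-1}\in\mathbb{R}^n$ is the vector with components $(\mathcal{A}\mathbf{x}^{m-1})_i=\sum_{i_2,\ldots,i_m=1}^n a_{ii_2\cdots i_m}x_{i_2}\cdots x_{i_m}$. Vector inequalities are componentwise. Tensor complementarity problem $(\mathbf{q},\mathcal{A})$, for $\mathbf{q}\in\mathbb{R}^n$: find $\mathbf{x}\in\mathbb{R}^n$ such that $\mathbf{x}\ge\mathbf{0}$, $\mathbf{q}+\mathcal{A}\mathbf{x}^{m-1}\ge\mathbf{0}$ and $\mathbf{x}^\top(\mathbf{q}+\mathcal{A}\mathbf{x}^{m-1})=0$. Such an $\mathbf{x}$ is called a solution. $\mathcal{A}$ is an R-tensor iff there are no $\mathbf{x}\in\mathbb{R}^n$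 and $t\in\mathbb{R}$ with $\mathbf{0}\neq\mathbf{x}\ge\mathbf{0}$, $t\ge 0$, such that $(\mathcal{A}\mathbf{x}^{m-1})_i+t=0$ for every $i$ with $x_i>0$ and $(\mathcal{A}\mathbf{x}^{m-1})_j+t\ge 0$ for every $j$ with $x_j=0$. $\mathcal{A}$ is an R$_0$-tensor iff this system has no solution $\mathbf{x}$ with $t=0$. *)

(* Defs.v *)
From HB Require Import structures.
From mathcomp Require Import all_boot all_order all_algebra.
From mathcomp Require Import reals.

Set Implicit Arguments.
Unset Strict Implicit.
Unset Printing Implicit Defensive.

Import Order.TTheory GRing.Theory Num.Theory.
Local Open Scope ring_scope.

(* The index set {1, ..., n} is represented by 'I_n = {0, ..., n-1}; the
   multi-index (i_1, ..., i_m) is an m-tuple. *)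
Definition tensor (R : realType) (m n : nat) := {ffun m.-tuple 'I_n -> R}.

(* A x^{m-1}.  The free indices i_2, ..., i_m of component i range over the
   m-tuples s with first entry i, and [behead s] is (i_2, ..., i_m). *)
Definition tensor_app (R : realType) (m n : nat) (A : tensor R m n)
    (x : 'cV[R]_n) : 'cV[R]_n :=
  \col_(i < n) \sum_(s : m.-tuple 'I_n | ohead s == Some i)
                 A s * \prod_(j <- behead s) x j 0.

Definition vec_ge0 (R : realType) (n : nat) (x : 'cV[R]_n) : Prop :=
  forall i, 0 <= x i 0.

Definition tcp_solution (R : realType) (m n : nat) (q : 'cV[R]_n)
    (A : tensor R m n) (x : 'cV[R]_n) : Prop :=
  [/\ vec_ge0 x,
      vec_ge0 (q + tensor_app A x) &
      x^T *m (q + tensor_app A x) = 0].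

Definition R_system (R : realType) (m n : nat) (A : tensor R m n)
    (x : 'cV[R]_n) (t : R) : Prop :=
  [/\ x <> 0,
      vec_ge0 x,
      0 <= t,
      forall i, 0 < x i 0 -> tensor_app A x i 0 + t = 0 &
      forall j, x j 0 = 0 -> 0 <= tensor_app A x j 0 + t].

Definition R_tensor (R : realType) (m n : nat) (A : tensor R m n) : Prop :=
  ~ exists (x : 'cV[R]_n) (t : R), R_system A x t.

Definition R0_tensor (R : realType) (m n : nat) (A : tensor R m n) : Prop :=
  ~ exists x : 'cV[R]_n, R_system A x 0.

(* Main.v *)
(** For t >= 0, [R_system A x t] says that [x] is a nonzero solution of the problem
    (t e, A).  Since A x^{m-1} is homogeneous of degree m - 1, the solutions of
    (c^{m-1} q, A) are the c-multiples of those of (q, A) for c > 0, so every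
    t > 0 reduces to t = 1 by extracting an (m-1)-th root of 1/t. *)
Require Import Defs.
From HB Require Import structures.
From mathcomp Require Import all_boot all_order all_algebra.
From mathcomp Require Import reals.

Set Implicit Arguments.
Unset Strict Implicit.
Unset Printing Implicit Defensive.

Import Order.TTheory GRing.Theory Num.Theory.
Local Open Scope ring_scope.

(** Intermediate value theorem for X^k - a; the root it gives is nonzero because a > 0. *)
Lemma exists_pos_root (R : rcfType) (k : nat) (a : R) :
  (0 < k)%N -> 0 < a -> exists2 c : R, 0 < c & c ^+ k = a.
Proof.
move=> k_gt0 a_gt0.
have b_ge1 : 1 <= 1 + a by rewrite lerDl ltW.
(* The right end 1 + a works for small and large a alike: it is at least 1, so (1 + a)^k >= 1 + a >=
   a. *)
have [||c /andP[c_ge0 _]] := @poly_ivt R ('X^k - a%:P) 0 (1 + a).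
- by rewrite (le_trans ler01).
- rewrite !hornerE expr0n gtn_eqF // sub0r oppr_le0 (ltW a_gt0).
  rewrite subr_ge0 /= (le_trans _ (ler_eXnr k_gt0 b_ge1)) //.
  by rewrite lerDr ler01.
rewrite rootE !hornerE subr_eq0 => /eqP cka.
exists c => //; rewrite lt_def c_ge0 andbT; apply/eqP => c0.
by move: a_gt0; rewrite -cka c0 expr0n gtn_eqF // ltxx.
Qed.

Section TensorComplementarity.
Variables (R : realType) (m n : nat) (A : tensor R m n).
Implicit Types (q x : 'cV[R]_n) (c t : R).

(** Each monomial has the m - 1 factors indexed by [behead s], and each of them contributes one
    c. *)
Lemma tensor_appZ c x :
  tensor_app A (c *: x) = c ^+ m.-1 *: tensor_app A x.
Proof.
apply/colP => i; rewrite !mxE mulr_sumr; apply: eq_bigr => s _.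
under eq_bigr do rewrite mxE.
by rewrite big_split /= big_const_seq count_predT iter_mulr_1 size_behead
           size_tuple mulrCA.
Qed.

(** Homogeneity at the scalar 0, where 0^(m-1) = 0 requires m >= 2; for m = 1 the map is constant
    and may be nonzero. *)
Lemma tensor_app0 : (1 < m)%N -> tensor_app A 0 = 0.
Proof.
move=> m_gt1; have /= := tensor_appZ 0 0.
by rewrite scaler0 expr0n -subn1 subn_eq0 leqNgt m_gt1 scale0r.
Qed.

Lemma tcp_solution0 q : (1 < m)%N -> vec_ge0 q -> tcp_solution q A 0.
Proof.
move=> m_gt1 q_ge0; split; first by move=> i; rewrite mxE.
- by rewrite tensor_app0 // addr0.
- by rewrite trmx0 mul0mx.
Qed.

Lemma tcp_solutionZ c q x : 0 <= c ->
  tcp_solution q A x -> tcp_solution (c ^+ m.-1 *: q) A (c *: x).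
Proof.
move=> c_ge0 [x_ge0 w_ge0 xw0]; rewrite /tcp_solution tensor_appZ -scalerDr.
split=> [i|i|]; first by rewrite mxE mulr_ge0.
- by rewrite mxE mulr_ge0 ?exprn_ge0.
- by rewrite -scalemxAr linearZ /= -scalemxAl xw0 !scaler0.
Qed.

(** The scalar product is a sum of nonnegative terms, so it vanishes exactly when every term
    does. *)
Lemma tcp_solution_complementary q x : tcp_solution q A x <->
  [/\ vec_ge0 x, vec_ge0 (q + tensor_app A x) &
      forall i, 0 < x i 0 -> (q + tensor_app A x) i 0 = 0].
Proof.
set w := q + _; split=> -[x_ge0 w_ge0 xw]; split=> //.
- have xw_ge0 i : true -> 0 <= x i 0 * w i 0 by rewrite mulr_ge0.
  have sum0 : \sum_i x i 0 * w i 0 = 0.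
    transitivity ((x^T *m w) 0 0); last by rewrite xw mxE.
    by rewrite mxE; apply: eq_bigr => i _; rewrite [x^T _ _]mxE.
  move=> i xi_gt0; have /eqP := psumr_eq0P xw_ge0 sum0 (erefl true : xpredT i).
  by rewrite mulf_eq0 gt_eqF //= => /eqP.
- apply/matrixP => i j; rewrite !ord1 [LHS]mxE [RHS]mxE big1 // => k _; rewrite [x^T _ _]mxE.
  have := x_ge0 k; rewrite le_eqVlt => /predU1P[<-|/xw ->].
    by rewrite mul0r.
  by rewrite mulr0.
Qed.

Lemma R_systemE x t : R_system A x t <->
  [/\ x <> 0, 0 <= t & tcp_solution (const_mx t) A x].
Proof.
have wE i : (const_mx t + tensor_app A x) i 0 = tensor_app A x i 0 + t.
  by rewrite addrC mxE [const_mx t i 0]mxE.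
split=> [[xN0 x_ge0 t_ge0 pos zero]|[xN0 t_ge0]].
  split=> //; apply/tcp_solution_complementary; split=> // i; rewrite wE.
    (* [R_system] states the sign condition only where x_i = 0; where x_i > 0 it follows from the
       equality. *)
    have := x_ge0 i; rewrite le_eqVlt => /predU1P[xi0|/pos -> //].
    exact: zero.
  exact: pos.
move/tcp_solution_complementary=> [x_ge0 w_ge0 compl].
split=> // i; first by rewrite -wE; exact: compl.
by rewrite -wE.
Qed.

(** As 0 always solves (t e, A) for t >= 0, uniqueness only excludes nonzero solutions. The cases t
    = 0 and t = 1 serve the two parts of the theorem. *)
Lemma unique_tcp_solution0 t : (1 < m)%N -> 0 <= t ->
  unique (tcp_solution (const_mx t) A) 0 <-> ~ exists x, R_system A x t.
Proof.
move=> m_gt1 t_ge0; split=> [[_ uniq0] [x /R_systemE[xN0 _ /uniq0 x0]]|noR].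
  exact: xN0.
split=> [|x xsol]; first by apply: tcp_solution0 => // i; rewrite mxE.
have [//|/eqP xN0] := eqVneq 0 x.
by case: noR; exists x; apply/R_systemE; split=> // x0; apply: xN0.
Qed.

Lemma R_system_pos x t : (1 < m)%N -> 0 < t -> R_system A x t ->
  exists y, R_system A y 1.
Proof.
move=> m_gt1 t_gt0 /R_systemE[xN0 _ xsol].
have k_gt0 : (0 < m.-1)%N by rewrite -subn1 subn_gt0.
have tV_gt0 : 0 < t^-1 by rewrite invr_gt0.
have [c c_gt0 ckE] := exists_pos_root k_gt0 tV_gt0.
exists (c *: x); apply/R_systemE; split=> //.
  by move=> /eqP; rewrite scaler_eq0 gt_eqF //= => /eqP.
have -> : const_mx 1 = c ^+ m.-1 *: const_mx t :> 'cV[R]_n.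
  by rewrite ckE scalemx_const mulVf // gt_eqF.
exact: tcp_solutionZ (ltW c_gt0) xsol.
Qed.

End TensorComplementarity.

Theorem proposition3p1 (R : realType) (m n : nat) (hm : (2 <= m)%N)
    (hn : (1 <= n)%N) (A : tensor R m n) :
  (R0_tensor A <-> unique (tcp_solution 0 A) 0) /\
  (R_tensor A <->
     R0_tensor A /\ unique (tcp_solution (const_mx 1) A) 0).
Proof.
(* The zero vector is [const_mx 0] by conversion, so part (i) is the case t = 0. *)
split; first exact: iff_sym (unique_tcp_solution0 A hm (lexx 0)).
have uniq1 := unique_tcp_solution0 A hm ler01.
split=> [RA|[R0A /uniq1 noR1] [x [t xt]]].
  split; first by case=> x x0; apply: RA; exists x, 0.
  by apply/uniq1; case=> x x1; apply: RA; exists x, 1.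
(* A solution with t = 0 contradicts [R0A]; one with t > 0 rescales to t = 1 and contradicts
   [noR1]. *)
have [_ _ + _ _] := xt; rewrite le_eqVlt => /predU1P[t0|t_gt0].
  by apply: R0A; exists x; rewrite t0.
exact: noR1 (R_system_pos hm t_gt0 xt).
Qed.
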